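(* Let $\mathfrak{h}$ be a Kähler Lie algebra of dimension $2n$, $c\in\mathbb{R}$, and $u,v$ derivations of $\mathfrak{h}$ such that $[u,v]=cv$. Consider $\mathfrak{r}_{2,c}\ltimes_{u,v}\mathfrak{h}$ with its product almost Hermitian structure $(g,J)$. 1. The almost complex structure $J$ on $\mathfrak{r}_{2,c}\ltimes_{u,v}\mathfrak{h}$ is integrable if and only if $$[v+uJ,J]=0$$ in $\mathrm{End}_{\mathbb R}(\mathfrak h)$. 2. The fundamental $2$-form $\Omega$ on $\mathfrak{r}_{2,c}\ltimes_{u,v}\mathfrak{h}$ is LCS with Lee form $\theta=U^\flat=g(U,\cdot)$ if and only if $$J+u^*J+Ju=0,\qquad v^*J+Jv=0,$$ where $x^*$ denotes the adjoint of $x\in\mathrm{End}_{\mathbb{R}}(\mathfrak{h})$ with respect to $g|_{\mathfrak h}$ and $J$ here is the complex structure of $\mathfrak h$. 3. The almost Hermitian structure on $\mathfrak{r}_{2,c}\ltimes_{u,v}\mathfrak{h}$ is an integrable LCK structure with Lee form $\theta$ if and only if all the conditions $[v+uJ,J]=0$, $J+u^*J+Ju=0$ and $v^*J+Jv=0$ hold.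
   Context: Lie algebras are real and finite-dimensional, $n\ge1$; the Chevalley-Eilenberg differential is $d\alpha(X,Y)=-\alpha([X,Y])$ on $1$-forms and $d\Omega(X,Y,Z)=-\Omega([X,Y],Z)-\Omega([Y,Z],X)-\Omega([Z,X],Y)$ on $2$-forms. An almost Hermitian structure on a Lie algebra is a pair $(g,J)$ with $g$ an inner product, $J^2=-\mathrm{Id}$, $g(JX,JY)=g(X,Y)$; its fundamental $2$-form is $\Omega(X,Y)=g(X,JY)$. $J$ is integrable if $N_J(X,Y)=[JX,JY]-[X,Y]-J[JX,Y]-J[X,JY]=0$ for all $X,Y$. It is Kähler if $J$ is integrable and $d\Omega=0$. The nondegenerate form $\Omega$ is LCS (locally conformal symplectic) with Lee form $\theta$ if $d\Omega=\theta\wedge\Omega$ and $d\theta=0$. The structure is LCK with Lee form $\theta$ if $J$ is integrable, $d\Omega=\theta\wedge\Omega$ and $d\theta=0$; setting $\eta(X)=-\theta(JX)$, it is integrable LCK if moreover $\eta\wedge d\eta=0$. $\mathfrak{r}_{2,c}$ is the Lie algebra with basis $U,V$ and bracket $[U,V]=cV$, equipped with $g$ making $U,V$ orthonormal and $JU=V$, $JV=-U$. For a Kähler Lie algebra $\mathfrak h$ with derivations $u,v$ such that $[u,v]=cv$, $\mathfrak{r}_{2,c}\ltimes_{u,v}\mathfrak h$ is the semidirect product in which $[U,Y]=uY$, $[V,Y]=vY$ for $Y\in\mathfrak h$, $\mathfrak h$ being an ideal and $\mathfrak r_{2,c}$ a subalgebra; it carries the product (orthogonal direct sum) almost Hermitian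 structure. *)

(* Defs.v *)
From HB Require Import structures.
From mathcomp Require Import all_boot all_order all_algebra.
From mathcomp Require Import boolp classical_sets reals.
From mathcomp Require Import ring.

Set Implicit Arguments.
Unset Strict Implicit.
Unset Printing Implicit Defensive.
Import Order.TTheory GRing.Theory Num.Theory.
Local Open Scope ring_scope.

HB.mixin Record Vector_isLie (R : realType) V of Vector R V := {
  bracket : V -> V -> V;
  bracket_bilinear : bilinear_for *:%R *:%R bracket;
  bracketxx : forall X, bracket X X = 0;
  jacobi : forall X Y Z,
    bracket X (bracket Y Z) + bracket Y (bracket Z X) +
    bracket Z (bracket X Y) = 0
}.

#[short(type="lieType")]
HB.structure Definition Lie (R : realType) := {V of Vector R V & Vector_isLie R V}.

HB.instance Definition _ (R : realType) (V : lieType R) :=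
  bilinear_isBilinear.Build R V V V *:%R *:%R (@bracket R V) bracket_bilinear.

Section BracketTheory.
Context {R : realType} {V : lieType R}.
Implicit Types (X Y Z : V).

Lemma bracketDl X Y Z : bracket (X + Y) Z = bracket X Z + bracket Y Z.
Proof. exact: linearDl. Qed.

Lemma bracketDr X Y Z : bracket X (Y + Z) = bracket X Y + bracket X Z.
Proof. exact: linearDr. Qed.

Lemma bracketNl X Y : bracket (- X) Y = - bracket X Y.
Proof. exact: linearNl. Qed.

Lemma bracketNr X Y : bracket X (- Y) = - bracket X Y.
Proof. exact: linearNr. Qed.

Lemma bracketZl a X Y : bracket (a *: X) Y = a *: bracket X Y.
Proof. exact: linearZl_LR. Qed.

Lemma bracketZr a X Y : bracket X (a *: Y) = a *: bracket X Y.
Proof. exact: linearZr_LR. Qed.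

Lemma bracketC X Y : bracket X Y = - bracket Y X.
Proof.
apply/eqP; rewrite -subr_eq0 opprK; apply/eqP.
have := bracketxx (X + Y).
by rewrite bracketDl !bracketDr !bracketxx addr0 add0r.
Qed.

Import VectorInternalTheory.

(* Reduces module identities to ring identities in coordinates. *)
Lemma eq_coord X Y :
  (forall f : V -> R, {morph f : x y / x + y} -> {morph f : x / - x} ->
     (forall a, {morph f : x / a *: x >-> a * x}) -> f X = f Y) -> X = Y.
Proof.
move=> eqXY; apply: (can_inj v2rK); apply/rowP => i.
by apply: (eqXY (fun Z => v2r Z 0 i)) => [Z T|Z|a Z];
  rewrite (linearD, linearN, linearZ) mxE.
Qed.

End BracketTheory.

Section ChevalleyEilenberg.
Context {R : realType} {V : lieType R}.
Implicit Types (alpha : V -> R) (omega : V -> V -> R) (X Y Z : V).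

Definition d1 alpha X Y : R := - alpha (bracket X Y).

Definition d2 omega X Y Z : R :=
  - omega (bracket X Y) Z - omega (bracket Y Z) X - omega (bracket Z X) Y.

(* Normalised without factorials, so that alpha /\ beta = alpha (x) beta -
   beta (x) alpha on 1-forms, consistently with d1 and d2. *)
Definition wedge12 alpha omega X Y Z : R :=
  alpha X * omega Y Z + alpha Y * omega Z X + alpha Z * omega X Y.

End ChevalleyEilenberg.

Section Endomorphisms.
Context {R : realType} {V : lieType R}.

Definition commutator (f g : 'End(V)) : 'End(V) := (f \o g)%VF - (g \o f)%VF.

Definition is_derivation (D : 'End(V)) : Prop :=
  forall X Y, D (bracket X Y) = bracket (D X) Y + bracket X (D Y).

Definition nijenhuis (J : 'End(V)) (X Y : V) : V :=
  bracket (J X) (J Y) - bracket X Y - J (bracket (J X) Y) - J (bracket X (J Y)).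

Definition integrable (J : 'End(V)) : Prop := forall X Y, nijenhuis J X Y = 0.

(* Existence and uniqueness: adjointP and adjoint_unique. *)
Definition adjoint (g : {dot V for @idfun R}) (x : 'End(V)) : 'End(V) :=
  xget 0 [set y : 'End(V) | forall X Y, g (x X) Y = g X (y Y)].

End Endomorphisms.

Section Metric.
Context {R : realType} {V : lieType R} (g : {dot V for @idfun R}).

Lemma metricC X Y : g X Y = g Y X.
Proof. by rewrite (hermC g) expr0 mul1r. Qed.

Lemma metricBl X Y Z : g (X - Y) Z = g X Z - g Y Z.
Proof. exact: linearBl. Qed.

Lemma metricBr X Y Z : g X (Y - Z) = g X Y - g X Z.
Proof. exact: linearBr. Qed.

Lemma metricPl a X Y Z : g (a *: X + Y) Z = a * g X Z + g Y Z.
Proof. exact: linearPl. Qed.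

Lemma metricPr a X Y Z : g X (a *: Y + Z) = a * g X Y + g X Z.
Proof. exact: linearPr. Qed.

Lemma metric_eq0 X : (forall Y, g X Y = 0) -> X = 0.
Proof.
move=> gX0; apply/eqP; apply: contraT => /neq0_dnorm_gt0 => /(_ idfun g).
by rewrite gX0 ltxx.
Qed.

Lemma metric_ge0 X : 0 <= g X X.
Proof.
have [->|/neq0_dnorm_gt0 /ltW //] := eqVneq X 0.
by rewrite -[X in g X _](subrr 0) metricBl subrr.
Qed.

Lemma flat_is_scalar (X : V) : scalar (g X).
Proof. by move=> a Y Z; rewrite metricPr. Qed.

Definition flat_fun (X : V) : V -> R := g X.

HB.instance Definition _ (X : V) :=
  GRing.isLinear.Build R V R *%R (flat_fun X) (flat_is_scalar X).

Definition flat (X : V) : {scalar V} := flat_fun X.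

Lemma riesz (f : {scalar V}) : exists X, forall Y, f Y = g X Y.
Proof.
pose phi (X : V) : 'Hom(V, R^o) := linfun (flat_fun X : V -> R^o).
have phiE X Y : phi X Y = g X Y by rewrite lfunE.
have phi_lin : linear phi.
  move=> a X Y; apply/lfunP => Z.
  by rewrite add_lfunE scale_lfunE !phiE metricPl.
pose phiL := GRing.isLinear.Build R V 'Hom(V, R^o) *:%R phi phi_lin.
pose phil : {linear V -> 'Hom(V, R^o)} := HB.pack phi phiL.
pose F := linfun phil.
have kF : lker F == 0%VS.
  by apply/lker0P => X Y; rewrite !lfunE /= => /lfunP e; apply/eqP;
     rewrite -subr_eq0; apply/eqP/metric_eq0 => Z; rewrite metricBl -!phiE e subrr.
have limF : limg F = fullv.
  apply/eqP; rewrite eqEdim subvf /= limg_dim_eq; last by rewrite (eqP kF) capv0.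
  by rewrite !dimvf /dim /= muln1.
have : linfun (f : V -> R^o) \in limg F by rewrite limF memvf.
case/memv_imgP => X _ /lfunP e; exists X => Y.
by have := e Y; rewrite lfunE [F X]lfunE /= phiE.
Qed.

Lemma adjointP (x : 'End(V)) X Y : g (x X) Y = g X (adjoint g x Y).
Proof.
move: X Y; rewrite /adjoint; set A := (X in xget _ X).
suff : A (xget 0 A) by [].
have ex_adj : forall Z, exists T, forall X, g (x X) Z = g X T.
  move=> Z.
  have linf : scalar (fun X => g (x X) Z).
    by move=> a X1 X2; rewrite linearP metricPl.
  pose fL := GRing.isLinear.Build R V R *%R (fun X => g (x X) Z) linf.
  pose f : {scalar V} := HB.pack (fun X => g (x X) Z) fL.
  by have [T fE] := riesz f; exists T => X'; rewrite [RHS]metricC; apply: fE.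
have [y yE] := choice ex_adj.
have y_lin : linear y.
  move=> a Z T; apply/eqP; rewrite -subr_eq0; apply/eqP/metric_eq0 => W.
  by rewrite metricC metricBr !metricPr -!yE metricPr subrr.
pose yL := GRing.isLinear.Build R V V *:%R y y_lin.
pose yl : {linear V -> V} := HB.pack y yL.
have Ayl : A (linfun yl) by move=> X Y; rewrite yE lfunE.
exact: xgetI Ayl.
Qed.

Lemma adjoint_unique (x y : 'End(V)) :
  (forall X Y, g (x X) Y = g X (y Y)) -> y = adjoint g x.
Proof.
move=> yP; apply/lfunP => Y; apply/eqP; rewrite -subr_eq0.
by apply/eqP/metric_eq0 => X; rewrite metricC metricBr -yP -adjointP subrr.
Qed.

End Metric.

Record almost_hermitian (R : realType) (V : lieType R) := AlmostHermitian {
  metric : {dot V for @idfun R};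
  cplx : 'End(V);
  cplxK : (cplx \o cplx)%VF = - \1%VF;
  metric_cplx : forall X Y, metric (cplx X) (cplx Y) = metric X Y
}.

Section AlmostHermitianTheory.
Context {R : realType} {V : lieType R} (S : almost_hermitian V).
Let g := metric S.
Let J := cplx S.

Lemma cplxKE X : J (J X) = - X.
Proof. by rewrite -comp_lfunE cplxK opp_lfunE id_lfunE. Qed.

Definition fundamental_fun (X Y : V) : R := g X (J Y).

Lemma fundamental_bilinear : bilinear_for *%R (@idfun R \; *%R) fundamental_fun.
Proof.
by split=> [Y a X Z|X a Y Z]; rewrite /fundamental_fun ?linearP ?linearPl ?linearPr.
Qed.

HB.instance Definition _ := bilinear_isBilinear.Build R V V R
  *%R (@idfun R \; *%R) fundamental_fun fundamental_bilinear.

Lemma fundamental_skew X Y :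
  fundamental_fun X Y = (-1) ^+ true * idfun (fundamental_fun Y X).
Proof.
rewrite /fundamental_fun /= expr1 mulN1r -(metric_cplx S) -/J cplxKE linearNr.
by rewrite metricC.
Qed.

HB.instance Definition _ :=
  isHermitianSesquilinear.Build R V true (@idfun R) fundamental_fun fundamental_skew.

Definition fundamental_form : {skew_symmetric V} := fundamental_fun.

Definition kahler : Prop :=
  integrable J /\ forall X Y Z, d2 fundamental_form X Y Z = 0.

Definition lck (theta : {scalar V}) : Prop :=
  [/\ integrable J,
      forall X Y Z,
        d2 fundamental_form X Y Z = wedge12 theta fundamental_form X Y Z &
      forall X Y, d1 theta X Y = 0].

Definition integrable_lck (theta : {scalar V}) : Prop :=
  let eta X := - theta (J X) in
  lck theta /\ forall X Y Z, wedge12 eta (d1 eta) X Y Z = 0.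

End AlmostHermitianTheory.

Definition lcs (R : realType) (V : lieType R)
    (omega : {skew_symmetric V}) (theta : {scalar V}) : Prop :=
  [/\ nondegenerate omega,
      forall X Y Z, d2 omega X Y Z = wedge12 theta omega X Y Z &
      forall X Y, d1 theta X Y = 0].

Record der_action (R : realType) (k h : lieType R) := DerAction {
  act :> {linear k -> 'End(h)};
  act_der : forall A, is_derivation (act A);
  act_bracket : forall A B, act (bracket A B) = commutator (act A) (act B)
}.

Definition semidirect (R : realType) (k h : lieType R) (rho : der_action k h) : Type :=
  (k * h)%type.

Section Semidirect.
Context {R : realType} {k h : lieType R} (rho : der_action k h).

HB.instance Definition _ := Vector.on (semidirect rho).

Definition semidirect_bracket (x y : semidirect rho) : semidirect rho :=
  (bracket x.1 y.1, bracket x.2 y.2 + rho x.1 y.2 - rho y.1 x.2).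

Lemma semidirect_bilinear : bilinear_for *:%R *:%R semidirect_bracket.
Proof.
split=> [y a x z|x a y z]; apply: injective_projections => /=;
  rewrite ?bracketDl ?bracketDr ?bracketZl ?bracketZr //.
  rewrite !linearP /= add_lfunE scale_lfunE.
  by apply: eq_coord => f fD fN fZ; rewrite !(fD, fN, fZ); ring.
rewrite !linearP /= add_lfunE scale_lfunE.
by apply: eq_coord => f fD fN fZ; rewrite !(fD, fN, fZ); ring.
Qed.

Lemma semidirect_bracketxx x : semidirect_bracket x x = 0.
Proof. by rewrite /semidirect_bracket !bracketxx add0r subrr. Qed.

Lemma semidirect_jacobi x y z :
  semidirect_bracket x (semidirect_bracket y z) +
  semidirect_bracket y (semidirect_bracket z x) +
  semidirect_bracket z (semidirect_bracket x y) = 0.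
Proof.
apply: injective_projections => /=; first exact: jacobi.
rewrite !bracketDr !bracketNr !linearB !linearD /= !act_bracket.
rewrite !add_lfunE !opp_lfunE !comp_lfunE /= !(act_der rho).
rewrite (bracketC (rho x.1 y.2)) (bracketC (rho y.1 z.2)) (bracketC (rho z.1 x.2)).
rewrite -[RHS](jacobi x.2 y.2 z.2).
by apply: eq_coord => f fD fN fZ; rewrite !(fD, fN); ring.
Qed.

HB.instance Definition _ := Vector_isLie.Build R (semidirect rho)
  semidirect_bilinear semidirect_bracketxx semidirect_jacobi.

Section ProductStructure.
Variables (S : almost_hermitian k) (T : almost_hermitian h).

Definition prod_metric_fun (x y : semidirect rho) : R :=
  metric S x.1 y.1 + metric T x.2 y.2.

Lemma prod_metric_bilinear : bilinear_for *%R (@idfun R \; *%R) prod_metric_fun.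
Proof.
split=> [y a x z|x a y z] /=; rewrite /prod_metric_fun /= ?metricPl ?metricPr.
  by rewrite mulrDr addrACA.
by rewrite mulrDr addrACA.
Qed.

HB.instance Definition _ := bilinear_isBilinear.Build R
  (semidirect rho) (semidirect rho) R
  *%R (@idfun R \; *%R) prod_metric_fun prod_metric_bilinear.

Lemma prod_metric_sym x y :
  prod_metric_fun x y = (-1) ^+ false * idfun (prod_metric_fun y x).
Proof.
by rewrite /prod_metric_fun expr0 mul1r /= metricC [X in _ + X]metricC.
Qed.

HB.instance Definition _ := isHermitianSesquilinear.Build R
  (semidirect rho) false (@idfun R) prod_metric_fun prod_metric_sym.

Lemma prod_metric_gt0 x : x != 0 -> 0 < prod_metric_fun x x.
Proof.
move=> x0; rewrite /prod_metric_fun.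
have [x10|x10] := eqVneq x.1 0; last first.
  exact: ltr_wpDr (metric_ge0 _ _) (neq0_dnorm_gt0 _ x10).
apply: ltr_wpDl (metric_ge0 _ _) (neq0_dnorm_gt0 _ _).
apply: contraNneq x0 => x20; apply/eqP.
exact: injective_projections.
Qed.

HB.instance Definition _ := isDotProduct.Build R
  (semidirect rho) prod_metric_fun prod_metric_gt0.

Definition prod_metric : {dot (semidirect rho) for @idfun R} := prod_metric_fun.

Definition prod_cplx_fun (x : semidirect rho) : semidirect rho :=
  (cplx S x.1, cplx T x.2).

Lemma prod_cplx_linear : linear prod_cplx_fun.
Proof.
by move=> a x y; apply: injective_projections; rewrite /= linearP.
Qed.

HB.instance Definition _ := GRing.isLinear.Build R
  (semidirect rho) (semidirect rho) *:%R prod_cplx_fun prod_cplx_linear.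

Definition prod_cplx : 'End(semidirect rho) := linfun prod_cplx_fun.

Lemma prod_cplxE x : prod_cplx x = (cplx S x.1, cplx T x.2).
Proof. by rewrite lfunE. Qed.

Lemma prod_cplxK : (prod_cplx \o prod_cplx)%VF = - \1%VF.
Proof.
apply/lfunP => x; rewrite comp_lfunE !prod_cplxE opp_lfunE id_lfunE.
by apply: injective_projections; rewrite /= cplxKE.
Qed.

Lemma prod_metric_cplx x y :
  prod_metric (prod_cplx x) (prod_cplx y) = prod_metric x y.
Proof. by rewrite !prod_cplxE /= /prod_metric_fun /= !metric_cplx. Qed.

Definition prod_almost_hermitian : almost_hermitian (semidirect rho) :=
  AlmostHermitian prod_cplxK prod_metric_cplx.

End ProductStructure.
End Semidirect.

(* The Lie algebra with basis U = (1, 0), V = (0, 1) and [U, V] = c V. *)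
Definition r2 (R : realType) (c : R) : Type := (R^o * R^o)%type.

Section R2.
Context {R : realType} (c : R).

HB.instance Definition _ := Vector.on (r2 c).

Definition r2U : r2 c := (1, 0).
Definition r2V : r2 c := (0, 1).

Definition r2_bracket (x y : r2 c) : r2 c := (0, c * (x.1 * y.2 - x.2 * y.1)).

Lemma r2_bilinear : bilinear_for *:%R *:%R r2_bracket.
Proof.
split=> [y a x z|x a y z]; apply: injective_projections => /=;
  by rewrite ?scaler0 ?addr0 // /GRing.scale /=; ring.
Qed.

Lemma r2_bracketxx x : r2_bracket x x = 0.
Proof. by apply: injective_projections => //=; ring. Qed.

Lemma r2_jacobi x y z :
  r2_bracket x (r2_bracket y z) + r2_bracket y (r2_bracket z x) +
  r2_bracket z (r2_bracket x y) = 0.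
Proof. by apply: injective_projections => /=; ring. Qed.

HB.instance Definition _ :=
  Vector_isLie.Build R (r2 c) r2_bilinear r2_bracketxx r2_jacobi.

Lemma r2_bracketUV : bracket r2U r2V = c *: r2V.
Proof.
by apply: injective_projections; rewrite /= /GRing.scale /=; ring.
Qed.

Definition r2_metric_fun (x y : r2 c) : R := x.1 * y.1 + x.2 * y.2.

Lemma r2_metric_bilinear : bilinear_for *%R (@idfun R \; *%R) r2_metric_fun.
Proof.
by split=> [y a x z|x a y z]; rewrite /r2_metric_fun /= /GRing.scale /=; ring.
Qed.

HB.instance Definition _ := bilinear_isBilinear.Build R (r2 c) (r2 c) R
  *%R (@idfun R \; *%R) r2_metric_fun r2_metric_bilinear.

Lemma r2_metric_sym x y :
  r2_metric_fun x y = (-1) ^+ false * idfun (r2_metric_fun y x).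
Proof. by rewrite /r2_metric_fun /=; ring. Qed.

HB.instance Definition _ := isHermitianSesquilinear.Build R (r2 c)
  false (@idfun R) r2_metric_fun r2_metric_sym.

Lemma r2_metric_gt0 x : x != 0 -> 0 < r2_metric_fun x x.
Proof.
move=> x0; rewrite /r2_metric_fun -!expr2 lt_neqAle addr_ge0 ?sqr_ge0 // andbT.
apply: contraNneq x0 => /esym/eqP.
rewrite paddr_eq0 ?sqr_ge0 // !sqrf_eq0 => /andP[/eqP x10 /eqP x20].
exact/eqP/injective_projections.
Qed.

HB.instance Definition _ := isDotProduct.Build R (r2 c) r2_metric_fun r2_metric_gt0.

Definition r2_metric : {dot (r2 c) for @idfun R} := r2_metric_fun.

Definition r2_cplx_fun (x : r2 c) : r2 c := (- x.2, x.1).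

Lemma r2_cplx_linear : linear r2_cplx_fun.
Proof.
by move=> a x y; apply: injective_projections => //=; rewrite opprD scalerN.
Qed.

HB.instance Definition _ := GRing.isLinear.Build R (r2 c) (r2 c) *:%R
  r2_cplx_fun r2_cplx_linear.

Definition r2_cplx : 'End(r2 c) := linfun r2_cplx_fun.

Lemma r2_cplxE x : r2_cplx x = (- x.2, x.1).
Proof. by rewrite lfunE. Qed.

Lemma r2_cplxU : r2_cplx r2U = r2V.
Proof. by rewrite r2_cplxE /= oppr0. Qed.

Lemma r2_cplxV : r2_cplx r2V = - r2U.
Proof. by rewrite r2_cplxE; apply: injective_projections; rewrite /= ?oppr0. Qed.

Lemma r2_cplxK : (r2_cplx \o r2_cplx)%VF = - \1%VF.
Proof.
apply/lfunP => x; rewrite comp_lfunE !r2_cplxE opp_lfunE id_lfunE.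
exact: injective_projections.
Qed.

Lemma r2_metric_cplx x y : r2_metric (r2_cplx x) (r2_cplx y) = r2_metric x y.
Proof. by rewrite !r2_cplxE /= /r2_metric_fun /=; ring. Qed.

Definition r2_almost_hermitian : almost_hermitian (r2 c) :=
  AlmostHermitian r2_cplxK r2_metric_cplx.

Section Action.
Context {h : lieType R} {u v : 'End(h)}.
Hypotheses (du : is_derivation u) (dv : is_derivation v).
Hypothesis uv : commutator u v = c *: v.

Definition r2_act_fun (x : r2 c) : 'End(h) :=
  (x.1 : R) *: u + (x.2 : R) *: v.

Lemma r2_act_linear : linear r2_act_fun.
Proof.
move=> a x y; rewrite /r2_act_fun /= !scalerDl scalerDr !scalerA.
by rewrite addrACA.
Qed.

HB.instance Definition _ := GRing.isLinear.Build R (r2 c) 'End(h) *:%R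
  r2_act_fun r2_act_linear.

Lemma r2_act_der x : is_derivation (r2_act_fun x).
Proof.
move=> X Y; rewrite !add_lfunE !scale_lfunE du dv.
rewrite !(bracketDl, bracketDr, bracketZl, bracketZr) !scalerDr.
by rewrite addrACA.
Qed.

Lemma r2_act_bracket x y :
  r2_act_fun (bracket x y) = commutator (r2_act_fun x) (r2_act_fun y).
Proof.
have uvE Z : u (v Z) = v (u Z) + c *: v Z.
  move/lfunP: uv => /(_ Z); rewrite add_lfunE opp_lfunE !comp_lfunE scale_lfunE.
  by move=> <-; rewrite addrC subrK.
apply/lfunP => Z; rewrite /r2_act_fun !add_lfunE opp_lfunE !comp_lfunE.
rewrite !(add_lfunE, scale_lfunE) !linearD !linearZ /= !uvE.
by apply: eq_coord => f fD fN fZ; rewrite /= !(fD, fN, fZ); ring.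
Qed.

Definition r2_act : der_action (r2 c) h := DerAction r2_act_der r2_act_bracket.

End Action.
End R2.

(* Main.v *)
Require Import Defs.
From mathcomp Require Import all_boot all_order all_algebra.
From mathcomp Require Import reals.
From mathcomp Require Import ring.

Set Implicit Arguments.
Unset Strict Implicit.
Unset Printing Implicit Defensive.
Import GRing.Theory.
Local Open Scope ring_scope.

(** All three equivalences come from comparing tensors on a semidirect product
    k |x h with their values on the two factors. For x = A + X with A in k and
    X in h, the Nijenhuis tensor and d Omega both split into a part on k, a part
    on h, and a mixed part built from the action rho of k on h:
    - [nijenhuis_prod]: the mixed part of the Nijenhuis tensor is N(A, Y), an
      element of h depending linearly on A;
    - [d2_fundamental_prod]: the mixed part of d Omega is
      d Omega(A, Y, Z) = - Omega(rho(A) Y, Z) - Omega(Y, rho(A) Z), which is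
      the natural action of the endomorphism rho(A) on the 2-form Omega_h.
    Taking vectors in single factors shows that J is integrable if and only if
    both factors are integrable and N(A, Y) vanishes ([integrable_prod]). In the
    same way d Omega = alpha /\ Omega, with alpha a 1-form on k, if and only if
    the equation holds on k, Omega_h is closed, and each rho(A) rescales
    Omega_h by - alpha(A) ([conformal_prod]). By nondegeneracy of the metric
    this last condition is an identity between endomorphisms of h,
    alpha(A) J + rho(A)^* J + J rho(A) = 0 ([conformal_derivation_adjoint]).

    The conditions on h are the Kaehler hypothesis, so only those on k = r_{2,c}
    and the mixed ones remain. On a plane, complex structures are integrable and
    3-forms vanish; theta is closed because every bracket is orthogonal to U.
    The mixed conditions need be tested only on a basis: those for A = U and
    A = V give the two adjoint identities, while
    N(U, Y) = [v + uJ, J] Y and N(V, Y) = N(JU, Y) = - J N(U, Y), so that the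
    single commutator decides integrability.

    Finally eta /\ d eta = 0 is automatic, because eta and d eta are pulled back
    from the plane. Integrable LCK is therefore the conjunction of the first two
    properties. *)

(** * Fundamental forms *)

Section FundamentalForm.
Context {R : realType} {V : lieType R} (S : almost_hermitian V).

Lemma fundamentalE X Y : fundamental_form S X Y = metric S X (cplx S Y).
Proof. by []. Qed.

Lemma fundamentalC X Y : fundamental_form S X Y = - fundamental_form S Y X.
Proof. by rewrite -[LHS]/(fundamental_fun S X Y) fundamental_skew expr1 mulN1r. Qed.

(** Omega(X, - JY) = g(X, Y), so the radical of Omega is that of g. *)
Lemma fundamental_nondegenerate : nondegenerate (fundamental_form S).
Proof.
rewrite /nondegenerate -subv0; apply/subvP => X /mem_orthovP orthX.
rewrite memv0; apply/eqP/(@metric_eq0 _ _ (metric S)) => Y.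
have := orthX (- cplx S Y) (memvf _).
by rewrite fundamentalE linearN /= cplxKE opprK.
Qed.

(** The endomorphism on the right represents, through the metric and up
    to sign, the difference of the two bilinear forms on the left. *)
Lemma conformal_derivation_adjoint (lambda : R) (x : 'End(V)) :
  (forall Y Z, - fundamental_form S (x Y) Z - fundamental_form S Y (x Z)
     = lambda * fundamental_form S Y Z) <->
  lambda *: cplx S + (adjoint (metric S) x \o cplx S)%VF + (cplx S \o x)%VF = 0.
Proof.
set P := _ + _ + _.
have PE Y Z : metric S Y (P Z) = lambda * fundamental_form S Y Z
    + fundamental_form S (x Y) Z + fundamental_form S Y (x Z).
  rewrite !add_lfunE scale_lfunE !comp_lfunE -addrA metricPr !fundamentalE.
  by rewrite adjointP -addrA linearDr.
split=> [eqx|P0 Y Z].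
  apply/lfunP => Z; rewrite zero_lfunE; apply: (@metric_eq0 _ _ (metric S)) => Y.
  by rewrite metricC PE -eqx; ring.
have := PE Y Z; rewrite P0 zero_lfunE linear0r => PE0.
by apply/eqP; rewrite -subr_eq0 -oppr_eq0 PE0; apply/eqP; ring.
Qed.

End FundamentalForm.

(** * Product structures on semidirect products *)

Section ProductStructure.
Context {R : realType} {k h : lieType R} (rho : der_action k h).
Context (S : almost_hermitian k) (T : almost_hermitian h).

Let P := prod_almost_hermitian rho S T.

(** The Nijenhuis tensor evaluated on A in k and Y in h, with every bracket
    between the factors expanded as an action of k. *)
Definition mixed_nijenhuis (A : k) (Y : h) : h :=
  rho (cplx S A) (cplx T Y) - rho A Y
    - cplx T (rho (cplx S A) Y) - cplx T (rho A (cplx T Y)).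

Lemma nijenhuis_prod (x y : semidirect rho) :
  nijenhuis (cplx P) x y =
  (nijenhuis (cplx S) x.1 y.1,
   nijenhuis (cplx T) x.2 y.2 + mixed_nijenhuis x.1 y.2 - mixed_nijenhuis y.1 x.2).
Proof.
rewrite /nijenhuis !prod_cplxE; apply: injective_projections => //=.
rewrite !linearB !linearD /= /mixed_nijenhuis.
by apply: eq_coord => f fD fN fZ; rewrite !(fD, fN); ring.
Qed.

(** Evaluating on pairs of vectors, each in one factor, isolates the three
    parts of the Nijenhuis tensor of the product. *)
Lemma integrable_prod :
  integrable (cplx P) <->
  [/\ integrable (cplx S), integrable (cplx T) &
      forall A Y, mixed_nijenhuis A Y = 0].
Proof.
have mixed0r A : mixed_nijenhuis A 0 = 0.
  by rewrite /mixed_nijenhuis !(linear0, subr0).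
have mixed0l Y : mixed_nijenhuis 0 Y = 0.
  by rewrite /mixed_nijenhuis !(linear0, zero_lfunE, subr0).
have nij0r (V : lieType R) (J : 'End(V)) X : nijenhuis J X 0 = 0.
  by rewrite /nijenhuis !(linear0, linear0r, subr0).
have nij0l (V : lieType R) (J : 'End(V)) X : nijenhuis J 0 X = 0.
  by rewrite /nijenhuis !(linear0, linear0l, subr0).
split=> [intP|[intS intT mixed0] x y]; last first.
  by rewrite nijenhuis_prod intS intT !mixed0 addr0 subr0.
have eqP x y : (nijenhuis (cplx P) x y).1 = 0 /\ (nijenhuis (cplx P) x y).2 = 0.
  by rewrite intP.
split=> [A B|X Y|A Y].
- by have [] := eqP (A, 0) (B, 0); rewrite nijenhuis_prod.
- by have [_] := eqP (0, X) (0, Y); rewrite nijenhuis_prod /= !mixed0l addr0 subr0.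
have [_] := eqP (A, 0) (0, Y).
by rewrite nijenhuis_prod /= mixed0l nij0l add0r subr0.
Qed.

Lemma fundamental_prodE (x y : semidirect rho) :
  fundamental_form P x y =
  fundamental_form S x.1 y.1 + fundamental_form T x.2 y.2.
Proof. by rewrite !fundamentalE prod_cplxE. Qed.

(** d Omega (A, Y, Z) for A in k and Y, Z in h: since [Y, Z] is orthogonal to
    JA, only the brackets with A contribute. *)
Definition omega_defect (A : k) (Y Z : h) : R :=
  - fundamental_form T (rho A Y) Z - fundamental_form T Y (rho A Z).

(** No term has two arguments in k and one in h: the bracket of two elements of
    k stays in k, that of A and Y lies in h, and Omega pairs the factors to 0. *)
Lemma d2_fundamental_prod (x y z : semidirect rho) :
  d2 (fundamental_form P) x y z =
  d2 (fundamental_form S) x.1 y.1 z.1 + d2 (fundamental_form T) x.2 y.2 z.2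
    + (omega_defect x.1 y.2 z.2 + omega_defect y.1 z.2 x.2
       + omega_defect z.1 x.2 y.2).
Proof.
rewrite /d2 !fundamental_prodE /= /omega_defect.
rewrite !(linearDl, linearNl) /=.
rewrite ![fundamental_form T _ (rho _ _)]fundamentalC; ring.
Qed.

Lemma wedge12_fundamental_prod (alpha : k -> R) (theta : semidirect rho -> R)
    (thetaE : forall w, theta w = alpha w.1) (x y z : semidirect rho) :
  wedge12 theta (fundamental_form P) x y z =
  wedge12 alpha (fundamental_form S) x.1 y.1 z.1
    + (alpha x.1 * fundamental_form T y.2 z.2
       + alpha y.1 * fundamental_form T z.2 x.2
       + alpha z.1 * fundamental_form T x.2 y.2).
Proof. by rewrite /wedge12 !fundamental_prodE !thetaE; ring. Qed.

(** Only triples of type (k, k, k), (h, h, h) and (k, h, h) give a condition; a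
    1-form pulled back from k vanishes on h, hence the closedness of Omega_h. *)
Lemma conformal_prod (alpha : {scalar k}) (theta : semidirect rho -> R)
    (thetaE : forall w, theta w = alpha w.1) :
  (forall x y z, d2 (fundamental_form P) x y z =
     wedge12 theta (fundamental_form P) x y z) <->
  [/\ forall A B C, d2 (fundamental_form S) A B C =
        wedge12 alpha (fundamental_form S) A B C,
      forall X Y Z, d2 (fundamental_form T) X Y Z = 0 &
      forall A, alpha A *: cplx T + (adjoint (metric T) (rho A) \o cplx T)%VF
        + (cplx T \o rho A)%VF = 0].
Proof.
have defectP A : (forall Y Z, omega_defect A Y Z = alpha A * fundamental_form T Y Z)
    <-> alpha A *: cplx T + (adjoint (metric T) (rho A) \o cplx T)%VF
        + (cplx T \o rho A)%VF = 0.
  exact: conformal_derivation_adjoint.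
split=> [conf|[confS closedT /(_ _)/defectP defT] x y z]; last first.
  by rewrite d2_fundamental_prod (wedge12_fundamental_prod thetaE) confS closedT !defT addr0.
have {}conf x y z := etrans (esym (d2_fundamental_prod x y z))
  (etrans (conf x y z) (wedge12_fundamental_prod thetaE x y z)).
split=> [A B C|X Y Z|A].
- have := conf (A, 0) (B, 0) (C, 0).
  by rewrite /d2 /omega_defect /= !(linear0, linear0l, linear0r, mulr0, subr0, addr0).
- have := conf (0, X) (0, Y) (0, Z).
  rewrite /d2 /wedge12 /omega_defect /=.
  by rewrite !(linear0, zero_lfunE, linear0l, linear0r, mul0r, oppr0, subr0, addr0, add0r).
apply/(defectP A) => Y Z; have := conf (A, 0) (0, Y) (0, Z).
rewrite /d2 /wedge12 /omega_defect /=.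
by rewrite !(linear0, zero_lfunE, linear0l, linear0r, mul0r, mulr0, oppr0, subr0, addr0, add0r).
Qed.

End ProductStructure.

(** * The plane r_{2,c} and its action *)

Section Plane.
Context {R : realType} (c : R).

Let S0 := r2_almost_hermitian c.

Lemma r2_integrable : integrable (cplx S0).
Proof.
move=> A B; rewrite /nijenhuis !r2_cplxE.
by apply: injective_projections; rewrite /=; ring.
Qed.

Lemma r2_conformal A B C :
  d2 (fundamental_form S0) A B C =
  wedge12 (flat (metric S0) (r2U c)) (fundamental_form S0) A B C.
Proof.
rewrite /d2 /wedge12 !fundamentalE !r2_cplxE.
by rewrite /= /flat_fun /= /r2_metric_fun /=; ring.
Qed.

Lemma r2_flatU (A : r2 c) : flat (metric S0) (r2U c) A = A.1.
Proof. by rewrite /= /flat_fun /= /r2_metric_fun /=; ring. Qed.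

Context {h : lieType R} {u v : 'End(h)}.
Hypotheses (du : is_derivation u) (dv : is_derivation v).
Hypothesis uv : commutator u v = c *: v.
Context (T : almost_hermitian h).

(** N is linear in A and satisfies N(JA, Y) = - J N(A, Y); as V = JU, it is
    determined by its value at U. *)
Lemma r2_mixed_nijenhuis A Y :
  let D := commutator (v + (u \o cplx T)%VF) (cplx T) in
  mixed_nijenhuis (r2_act du dv uv) S0 T A Y =
  A.1 *: D Y - A.2 *: cplx T (D Y).
Proof.
rewrite /= /mixed_nijenhuis /commutator r2_cplxE /= /r2_act_fun /=.
rewrite !(add_lfunE, opp_lfunE, comp_lfunE, scale_lfunE).
have lfunD (x : 'End(h)) Y1 Y2 : x (Y1 + Y2) = x Y1 + x Y2 by rewrite linearD.
have lfunN (x : 'End(h)) Y1 : x (- Y1) = - x Y1 by rewrite linearN.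
have lfunZ (x : 'End(h)) a Y1 : x (a *: Y1) = a *: x Y1 by rewrite linearZ.
rewrite !(lfunD, lfunN, lfunZ, cplxKE).
by apply: eq_coord => f fD fN fZ; rewrite !(fD, fN, fZ) /=; ring.
Qed.

(** On the side of bilinear forms the condition is linear in A, hence it follows
    from its instances at U and V, where theta takes the values 1 and 0. *)
Lemma r2_action_conformal :
  (forall A : r2 c, flat (metric S0) (r2U c) A *: cplx T
      + (adjoint (metric T) (r2_act du dv uv A) \o cplx T)%VF
      + (cplx T \o r2_act du dv uv A)%VF = 0) <->
  cplx T + (adjoint (metric T) u \o cplx T)%VF + (cplx T \o u)%VF = 0 /\
  (adjoint (metric T) v \o cplx T)%VF + (cplx T \o v)%VF = 0.
Proof.
split=> [adjA|[adju adjv] A].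
  split.
    have := adjA (r2U c).
    by rewrite r2_flatU /= /r2_act_fun /= !scale1r scale0r addr0.
  have := adjA (r2V c).
  by rewrite r2_flatU /= /r2_act_fun /= scale1r !scale0r !add0r.
have confu Y Z : - fundamental_form T (u Y) Z - fundamental_form T Y (u Z)
    = 1 * fundamental_form T Y Z.
  by move: Y Z; apply/conformal_derivation_adjoint; rewrite scale1r.
have confv Y Z : - fundamental_form T (v Y) Z - fundamental_form T Y (v Z)
    = 0 * fundamental_form T Y Z.
  by move: Y Z; apply/conformal_derivation_adjoint; rewrite scale0r add0r.
apply/conformal_derivation_adjoint => Y Z.
rewrite r2_flatU /= /r2_act_fun !(add_lfunE, scale_lfunE).
rewrite linearDl linearDr !(linearZl_LR, linearZr_LR) /=.
(* Exhibits theta(A) as A.1 theta(U) + A.2 theta(V). *)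
have -> : A.1 * fundamental_form T Y Z = A.1 * (1 * fundamental_form T Y Z)
  + A.2 * (0 * fundamental_form T Y Z) by ring.
by rewrite -confu -confv; ring.
Qed.

End Plane.

(** * The characterisation *)

Theorem proposition5p2 (R : realType) (n : nat) (hn : (1 <= n)%N)
    (h : lieType R) (dimh : \dim {:h} = (2 * n)%N)
    (H : almost_hermitian h) (kahlerH : kahler H)
    (c : R) (u v : 'End(h))
    (du : is_derivation u) (dv : is_derivation v)
    (uv : commutator u v = c *: v) :
  let S := prod_almost_hermitian (r2_act du dv uv) (r2_almost_hermitian c) H in
  let U : semidirect (r2_act du dv uv) := (r2U c, 0) in
  let theta := flat (metric S) U in
  let J := cplx H in
  let adj := adjoint (metric H) in
  [/\ integrable (cplx S) <-> commutator (v + (u \o J)%VF) J = 0,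
      lcs (fundamental_form S) theta <->
        J + (adj u \o J)%VF + (J \o u)%VF = 0 /\
        (adj v \o J)%VF + (J \o v)%VF = 0 &
      integrable_lck S theta <->
        [/\ commutator (v + (u \o J)%VF) J = 0,
            J + (adj u \o J)%VF + (J \o u)%VF = 0 &
            (adj v \o J)%VF + (J \o v)%VF = 0]].
Proof.
move=> S U theta J adj.
have [intH closedH] := kahlerH.
have thetaE x : theta x = x.1.1.
  by rewrite /theta /= /flat_fun /= /prod_metric_fun /= linear0l addr0 -r2_flatU.
have intP : integrable (cplx S) <-> commutator (v + (u \o J)%VF) J = 0.
  split=> [/integrable_prod[_ _ D0]|D0].
    apply/lfunP => Y; have := D0 (r2U c) Y.
    by rewrite r2_mixed_nijenhuis /= scale1r scale0r subr0 zero_lfunE.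
  apply/integrable_prod; split=> // [|A Y]; first exact: r2_integrable.
  by rewrite r2_mixed_nijenhuis -/J D0 zero_lfunE !(linear0, scaler0, subr0).
have closed_theta X Y : d1 theta X Y = 0.
  by rewrite /d1 thetaE /= oppr0.
have confP : (forall X Y Z, d2 (fundamental_form S) X Y Z =
      wedge12 theta (fundamental_form S) X Y Z) <->
    J + (adj u \o J)%VF + (J \o u)%VF = 0 /\ (adj v \o J)%VF + (J \o v)%VF = 0.
  rewrite -(r2_action_conformal du dv uv).
  have thetaU x : theta x = flat (r2_metric c) (r2U c) x.1 by rewrite thetaE r2_flatU.
  split=> [/(conformal_prod _ _ thetaU)[]//|actA].
  by apply/(conformal_prod _ _ thetaU); split=> //; exact: r2_conformal.
have lckP : integrable_lck S theta <-> [/\ integrable (cplx S),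
    forall X Y Z, d2 (fundamental_form S) X Y Z =
      wedge12 theta (fundamental_form S) X Y Z & forall X Y, d1 theta X Y = 0].
  split=> [[]//|lckS]; split=> // X Y Z.
  (* eta is the covector dual to V, and d eta = - c theta /\ eta. *)
  by rewrite /wedge12 /d1 !thetaE !prod_cplxE /= !r2_cplxE /=; ring.
split.
- exact: intP.
- split=> [[_ /confP //]|/confP conf].
  by split=> //; exact: fundamental_nondegenerate.
split=> [/lckP[/intP ? /confP[? ?] _]//|[/intP ? ? ?]].
by apply/lckP; split=> //; apply/confP.
Qed.
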